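(* Let $\mu$ be a measure on $\partial\mathbb{D}$ of the form $d\mu(e^{i\theta})=w(\theta)\frac{d\theta}{2\pi}+d\mu_{\mathrm{s}}(e^{i\theta})$, with $\mu_{\mathrm{s}}$ Lebesgue singular and $w(\theta)>0$ for a.e. $\theta$. Then $\mu$ is regular (for $E=\partial\mathbb{D}$, whose logarithmic capacity is $1$), that is, $$\lim_{n\to\infty}(\rho_1\cdots\rho_n)^{1/n}=1.$$
   Context: $\partial\mathbb{D}=\{z\in\mathbb{C}:|z|=1\}$. Measures are positive, finite, not necessarily normalized. $\Phi_n$ is the monic orthogonal polynomial of degree $n$ for $\mu$; with $\Phi_n^*(z)=z^n\,\overline{\Phi_n(1/\bar z)}$ the Verblunsky coefficients $\alpha_n$ are defined by $\Phi_{n+1}(z)=z\Phi_n(z)-\bar\alpha_n\Phi_n^*(z)$, and $\rho_n=(1-|\alpha_n|^2)^{1/2}$. *)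

(* Defs.v *)
From HB Require Import structures.
From mathcomp Require Import all_boot all_order all_algebra.
From mathcomp Require Export complex.
From mathcomp Require Import all_classical all_reals all_analysis.

Set Implicit Arguments.
Unset Strict Implicit.
Unset Printing Implicit Defensive.

Import Order.TTheory GRing.Theory Num.Theory numFieldNormedType.Exports.

Local Open Scope classical_set_scope.
Local Open Scope ring_scope.

Record circle (R : realType) : Type :=
  Circle { cval :> R[i] ; circle_norm : `|cval| == 1 }.

HB.instance Definition _ (R : realType) := [isSub for @cval R].
HB.instance Definition _ (R : realType) := [Choice of circle R by <:].

Lemma norm_expi (R : realType) (t : R) : `|(cos t +i* sin t)%C| == 1.
Proof. by rewrite normc_def /= cos2Dsin2 sqrtr1. Qed.

Definition expi (R : realType) (t : R) : circle R := Circle (norm_expi t).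

HB.instance Definition _ (R : realType) :=
  isPointed.Build (circle R) (expi 0).

(* Borel structure of the topology induced by that of R[i]; the latter is
   found on R[i]^o. *)
Definition circle_open (R : realType) : set (set (circle R)) :=
  [set A | exists2 U : set R[i]^o, open U & A = @cval R @^-1` U].

HB.instance Definition _ (R : realType) :=
  Measurable.copy (circle R) (g_sigma_algebraType (@circle_open R)).

Section OPUC.
Context {R : realType}.
Implicit Types (mu : {finite_measure set (circle R) -> \bar R}) (n : nat).

Definition cintegral mu (f : circle R -> R[i]) : R[i] :=
  ((\int[mu]_z complex.Re (f z)) +i* (\int[mu]_z complex.Im (f z)))%C.

Definition is_monic_OP mu n (P : {poly R[i]}) : Prop :=
  [/\ P \is monic, size P = n.+1 &
      forall k, (k < n)%N ->
        cintegral mu (fun z => ((z : R[i]) ^+ k)^* * P.[z]) = 0].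

(* xget is a definite description here: when the support of mu is infinite,
   exactly one P satisfies is_monic_OP mu n (and exactly one coefficient
   satisfies the recurrence below). *)
Definition monic_OP mu n : {poly R[i]} := xget 0 [set P | is_monic_OP mu n P].

(* The reversal is relative to the formal degree n; see horner_rev_poly. *)
Definition rev_poly n (P : {poly R[i]}) : {poly R[i]} :=
  \poly_(i < n.+1) (P`_(n - i))^*.

Lemma horner_rev_poly n (P : {poly R[i]}) (z : R[i]) :
  (size P <= n.+1)%N -> z != 0 ->
  (rev_poly n P).[z] = z ^+ n * (P.[(z^*)^-1])^*.
Proof.
move=> sP z0; rewrite horner_poly (horner_coef_wide _ sP) rmorph_sum mulr_sumr.
rewrite (reindex_inj rev_ord_inj) /=; apply: eq_bigr => i _.
have le_in : (i <= n)%N by rewrite -ltnS.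
rewrite subSS subKn // rmorphM rmorphXn fmorphV /= conjCK mulrCA; congr (_ * _).
by rewrite -[X in z ^+ X * _](subnK le_in) exprD -mulrA exprVn divff ?mulr1 ?expf_neq0.
Qed.

Definition verblunsky mu n : R[i] :=
  xget 0 [set a : R[i] | monic_OP mu n.+1 =
    'X * monic_OP mu n - (a^*)%:P * rev_poly n (monic_OP mu n)].

Definition rho mu n : R := Num.sqrt (1 - Normc.normc (verblunsky mu n) ^+ 2).

(* The right-hand side 1 is the logarithmic capacity of the unit circle. *)
Definition circle_regular mu : Prop :=
  (\prod_(1 <= k < n.+1) rho mu k) `^ n%:R^-1 @[n --> \oo] --> (1 : R).

Definition lebesgue_singular (nu : {measure set (circle R) -> \bar R}) : Prop :=
  exists N : set (circle R),
    [/\ measurable N,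
        lebesgue_measure (`[0, pi *+ 2[ `&` (@expi R) @^-1` N) = 0%E &
        nu (~` N) = 0%E].

End OPUC.

(* Main.v *)
Require Import Defs.
From mathcomp Require Import all_boot all_order all_algebra.
From mathcomp Require Import all_classical all_reals all_analysis.
From mathcomp Require Import ring lra measurable_realfun.

(** Why the theorem is true.  Write N_n for the squared L^2(mu) norm of the
    monic orthogonal polynomial Phi_n.  The recursion gives
    N_(n+1) = (1 - |alpha_n|^2) N_n, so that rho_1 ... rho_n is the square root
    of N_(n+1) / N_1 ([prod_rho]), and regularity says that ln N_n = o(n).  As
    N_n decreases, only a lower bound for ln N_n is at stake.

    The lower bound compares ln N_n with the mean of ln |Phi_n|^2 for Lebesgue
    measure.  The zeros of Phi_n lie in the open unit disk ([root_monic_OP]);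
    hence |Phi_n|^2 <= 4^n on the circle, and the integral of
    ln |Phi_n(e^(it))|^2 over a period is nonnegative ([log_prod_XsubC]).  Let
    A be the set where w >= d and B its complement in the period.  On A the
    inequality ln y <= ln N + y / N with N = N_n bounds the integral by
    |A| ln N_n + 2 pi / d, because d / (2 pi) times Lebesgue measure on A is
    dominated by mu ([density_ge_sqnorm]).  On B it is at most |B| n ln 4.
    Together, 0 <= |A| ln N_n + 2 pi / d + |B| n ln 4 ([log_sqnorm_lower]).
    Since w > 0 almost everywhere, |B| is as small as desired for small d
    ([density_ge_complement]); dividing by n gives the claim.

    The same domination shows that a nonzero polynomial has positive norm
    ([sqnorm_gt0]), on which the existence and uniqueness of the Phi_n rest. *)

Set Implicit Arguments.
Unset Strict Implicit.
Unset Printing Implicit Defensive.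

Import Order.TTheory GRing.Theory Num.Theory numFieldNormedType.Exports.

Local Open Scope classical_set_scope.
Local Open Scope ring_scope.

(** * The logarithmic mean of a linear factor *)

Section log_mean.
Context {R : realType}.
Implicit Types (f : R -> R) (x y t : R).

Notation leb := (@lebesgue_measure R).

Lemma continuous_itv_integrable f (a b : R) :
  continuous f -> leb.-integrable `[a, b] (EFin \o f).
Proof.
move=> cf; apply: continuous_compact_integrable; first exact: segment_compact.
exact: continuous_subspaceT.
Qed.

(** The integral starts at -1 so that the primitive is differentiable at 0,
    the left end of the period. *)
Lemma continuous_primitive f (b : R) : continuous f -> 0 <= b ->
  exists F : R -> R, (forall x, -1 < x -> is_derive x 1 F (f x)) /\
    \int[leb]_(t in `[0, b]) f t = F b - F 0.
Proof.
move=> cf b0; pose F x := \int[leb]_(t in `[-1, x]) f t; exists F; split.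
  move=> x x1; have x2 : x < x + 1 by lra.
  have intf := continuous_itv_integrable (-1) (x + 1) cf.
  have [dF eF] := continuous_FTC1_closed x2 intf x1 (cf x).
  by split; [exact: dF|rewrite -derive1E; exact: eF].
rewrite /F Rintegral_itvB ?bnd_simp //; last exact: (continuous_itv_integrable (-1) b cf).
rewrite Rintegral_itv_obnd_cbnd //.
by apply: integrableS (continuous_itv_integrable 0 b cf) => //; apply: subset_itvr; rewrite bnd_simp.
Qed.

(** The squared distance |e^(it) - (x + iy)|^2, expanded so that its dependence
    on t is through a single linear form in cos t and sin t. *)
Definition chord2 x y t : R := 1 - 2 * (x * cos t + y * sin t) + (x ^+ 2 + y ^+ 2).

(** The square of |e^(it) - a| >= 1 - |a| >= (1 - |a|^2) / 2, in a form free of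
    square roots. *)
Lemma chord2_lower x y t : x ^+ 2 + y ^+ 2 <= 1 ->
  (1 - (x ^+ 2 + y ^+ 2)) ^+ 2 / 4 <= chord2 x y t.
Proof.
move=> xy1; have := cos2Dsin2 t; rewrite /chord2.
set c := cos t; set s := sin t => cs.
have : (x * c + y * s) ^+ 2 + (x * s - y * c) ^+ 2 = x ^+ 2 + y ^+ 2.
  by rewrite -[RHS]mulr1 -cs; ring.
set u := x * c + y * s; have := sqr_ge0 (x * s - y * c).
set v := (X in 0 <= X) => v0 uv.
set r := (x ^+ 2 + _) in xy1 uv *.
rewrite -/v in uv; clearbody u v r.
have uu : u ^+ 2 <= 1 by lra.
have u1 : u <= 1 by nra.
have u2 : -1 <= u by nra.
have h : 1 - r <= 2 * (1 - u) by nra.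
have : (1 - r) ^+ 2 <= (2 * (1 - u)) ^+ 2.
  by rewrite ler_pXn2r // ?nnegrE; lra.
by nra.
Qed.

Lemma chord2_gt0 x y t : x ^+ 2 + y ^+ 2 < 1 -> 0 < chord2 x y t.
Proof.
move=> xy1; apply: lt_le_trans (chord2_lower t (ltW xy1)).
by rewrite divr_gt0 ?exprn_gt0 ?subr_gt0.
Qed.

(** This is |z - a| |z + a| = |z^2 - a^2| for z = e^(it) and a = x + iy. *)
Lemma chord2_double x y t :
  chord2 x y t * chord2 x y (t + pi) =
  chord2 (x ^+ 2 - y ^+ 2) (2 * x * y) (2 * t).
Proof.
rewrite /chord2 cosDpi sinDpi (mulr_natl t 2) cos_mulr2n sin_mulr2n.
have : sin t ^+ 2 = 1 - cos t ^+ 2 by rewrite -(cos2Dsin2 t); ring.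
set c := cos t; set s := sin t => cs.
apply/eqP; rewrite -subr_eq0; apply/eqP.
transitivity ((s ^+ 2 - (1 - c ^+ 2)) * (- 4 * y ^+ 2)); first by ring.
by rewrite cs subrr mul0r.
Qed.

Lemma continuous_chord2 x y : continuous (chord2 x y).
Proof.
move=> t; rewrite /chord2; apply: cvgD; last exact: cvg_cst.
apply: cvgB; first exact: cvg_cst.
apply: cvgM; first exact: cvg_cst.
by apply: cvgD; apply: cvgM; try exact: cvg_cst; [exact: continuous_cos|exact: continuous_sin].
Qed.

Lemma continuous_ln_chord2 x y : x ^+ 2 + y ^+ 2 < 1 ->
  continuous (@ln R \o chord2 x y).
Proof.
move=> xy1 t; apply: continuous_comp; first exact: continuous_chord2.
by apply: continuous_ln; exact: chord2_gt0.
Qed.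

Definition log_chord2 x y : R := \int[leb]_(t in `[0, pi *+ 2]) ln (chord2 x y t).

Lemma sqr_mod x y : (x ^+ 2 - y ^+ 2) ^+ 2 + (2 * x * y) ^+ 2 = (x ^+ 2 + y ^+ 2) ^+ 2.
Proof. by ring. Qed.

(** Averaging [chord2_double] over a period: t and t + pi run through the circle
    once while 2t runs through it twice.  The substitution is carried out on
    primitives: D, built from primitives of both sides, has derivative 0 on
    [0, pi]. *)
Lemma log_chord2_double x y : x ^+ 2 + y ^+ 2 < 1 ->
  log_chord2 (x ^+ 2 - y ^+ 2) (2 * x * y) = 2 * log_chord2 x y.
Proof.
move=> xy1.
have xy2 : (x ^+ 2 - y ^+ 2) ^+ 2 + (2 * x * y) ^+ 2 < 1.
  by rewrite sqr_mod expr_lt1 // addr_ge0 ?sqr_ge0.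
have pi0 := pi_gt0 R.
have pi2 : 0 <= (pi : R) *+ 2 by rewrite mulrn_wge0 // ltW.
have [F [dF iF]] := continuous_primitive (continuous_ln_chord2 xy1) pi2.
have [G [dG iG]] := continuous_primitive (continuous_ln_chord2 xy2) pi2.
rewrite /log_chord2 iF iG /=.
pose D t := F t + (F \o (fun s => s + pi)) t - 2^-1 * (G \o (fun s => 2 * s)) t.
have dD t : - 2^-1 < t -> is_derive t 1 D 0.
  move=> t1.
  have d1 := dF t ltac:(lra).
  have d2 : is_derive (t + pi) 1 F (ln (chord2 x y (t + pi))) by apply: dF; lra.
  have d3 : is_derive (2 * t) 1 G (ln (chord2 (x ^+ 2 - y ^+ 2) (2 * x * y) (2 * t))).
    by apply: dG; lra.
  have d4 : is_derive t 1 (fun s : R => s + pi) 1.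
    by apply: is_derive_eq; rewrite addr0.
  have d5 : is_derive t 1 (fun s : R => 2 * s) 2.
    by apply: is_derive_eq; rewrite /GRing.scale /= mulr1.
  have d6 := @is_derive1_comp _ F (fun s => s + pi) t _ _ d2 d4.
  have d7 := @is_derive1_comp _ G (fun s => 2 * s) t _ _ d3 d5.
  rewrite /D; apply: is_derive_eq.
  rewrite -chord2_double lnM ?posrE ?chord2_gt0 // /GRing.scale /=; lra.
have cD : {within `[0, pi], continuous D}.
  apply: derivable_within_continuous => t /[!in_itv] /= /andP[t0 _].
  by have /@ex_derive := dD t ltac:(lra).
have [|c _] := @MVT_segment _ D (fun=> 0) 0 pi (ltW pi0) _ cD.
  by move=> t /[!in_itv] /= /andP[t0 _]; apply: dD; lra.
by rewrite mul0r /D /= add0r mulr0 -[pi + pi]mulr2n mulr_natl; lra.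
Qed.

Lemma log_chord2_lower x y (r : R) : x ^+ 2 + y ^+ 2 <= r -> r < 1 ->
  pi *+ 2 * ln ((1 - r) ^+ 2 / 4) <= log_chord2 x y.
Proof.
move=> xyr r1; have xy1 := le_lt_trans xyr r1.
have pi0 := pi_gt0 R.
have -> : pi *+ 2 * ln ((1 - r) ^+ 2 / 4) =
    \int[leb]_(t in `[0, pi *+ 2]) ln ((1 - r) ^+ 2 / 4).
  rewrite Rintegral_cst //= lebesgue_measure_itv /= lte_fin mulrn_wgt0 //=.
  by rewrite oppr0 addr0 mulrC.
apply: le_Rintegral => //.
- by apply: continuous_itv_integrable => t; exact: cvg_cst.
- exact: continuous_itv_integrable (continuous_ln_chord2 xy1).
move=> t _; rewrite ler_ln ?posrE ?chord2_gt0 //; last first.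
  by rewrite divr_gt0 ?exprn_gt0 ?subr_gt0.
apply: le_trans (chord2_lower t (ltW xy1)).
rewrite ler_pM2r ?invr_gt0 //.
by rewrite ler_pXn2r // ?nnegrE; lra.
Qed.

(** With I(a) for the integral of ln |z - a|^2, doubling gives
    I(a) = I(a^(2^k)) / 2^k, and I is bounded below on the disk of squared
    radius r, which squaring preserves. *)
Lemma log_chord2_ge0 x y : x ^+ 2 + y ^+ 2 < 1 -> 0 <= log_chord2 x y.
Proof.
set r := _ + _ => r1.
set C := pi *+ 2 * ln ((1 - r) ^+ 2 / 4).
(* C / 2 ^ k tends to 0, so it suffices to bound by it for every k *)
have H k : forall a b, a ^+ 2 + b ^+ 2 <= r -> C / 2 ^+ k <= log_chord2 a b.
  elim: k => [|k IH] a b abr.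
    by rewrite expr0 divr1; exact: log_chord2_lower.
  have ab0 : 0 <= a ^+ 2 + b ^+ 2 by rewrite addr_ge0 ?sqr_ge0.
  have := IH (a ^+ 2 - b ^+ 2) (2 * a * b).
  rewrite sqr_mod log_chord2_double ?(le_lt_trans abr) // => /(_ _)H.
  have {}H : C / 2 ^+ k <= 2 * log_chord2 a b.
    by apply: H; apply: le_trans (abr); rewrite expr2 ler_piMl // (le_trans abr) // ltW.
  rewrite exprS invfM mulrCA; lra.
have c : (fun k => C / 2 ^+ k) @ \oo --> (0 : R).
  rewrite -[X in _ --> X](mulr0 C); apply: cvgM; first exact: cvg_cst.
  rewrite [X in X @ _ --> _](_ : _ = (fun k => (2^-1 : R) ^+ k)).
    by apply: cvg_expr; rewrite gtr0_norm ?invr_gt0 //; lra.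
  by apply/funext => k; rewrite exprVn.
rewrite -(cvg_lim (@Rhausdorff R) c); apply: limr_le; first by apply/cvg_ex; exists 0.
by apply: nearW => k; exact: H.
Qed.

End log_mean.

(** * Squared moduli of complex numbers *)

Section complex_algebra.
Context {R : realType}.
Implicit Types (z u : R[i]) (c : R).

Definition absq z : R := complex.Re z ^+ 2 + complex.Im z ^+ 2.

Lemma ReD z u : complex.Re (z + u) = complex.Re z + complex.Re u.
Proof. by case: z u => [? ?] [? ?]. Qed.
Lemma ImD z u : complex.Im (z + u) = complex.Im z + complex.Im u.
Proof. by case: z u => [? ?] [? ?]. Qed.
Lemma ReM z u : complex.Re (z * u) =
  complex.Re z * complex.Re u - complex.Im z * complex.Im u.
Proof. by case: z u => [? ?] [? ?]. Qed.
Lemma ImM z u : complex.Im (z * u) =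
  complex.Re z * complex.Im u + complex.Im z * complex.Re u.
Proof. by case: z u => [? ?] [? ?]. Qed.
Lemma ReJ z : complex.Re (z^*) = complex.Re z.
Proof. by case: z. Qed.
Lemma ImJ z : complex.Im (z^*) = - complex.Im z.
Proof. by case: z. Qed.

Lemma complex_ext z u : complex.Re z = complex.Re u ->
  complex.Im z = complex.Im u -> z = u.
Proof. by case: z u => [? ?] [? ?] /= -> ->. Qed.

Lemma absqE z : (absq z)%:C%C = z^* * z.
Proof.
by apply: complex_ext; rewrite /= ?ReM ?ImM ReJ ImJ /absq; ring.
Qed.

Lemma absqM z u : absq (z * u) = absq z * absq u.
Proof. by rewrite /absq ReM ImM; ring. Qed.

Lemma absq1 : absq 1 = 1.
Proof. by rewrite /absq /= expr1n expr0n addr0. Qed.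

Lemma absqJ z : absq z^* = absq z.
Proof. by rewrite /absq ReJ ImJ sqrrN. Qed.

Lemma absq_ge0 z : 0 <= absq z.
Proof. by rewrite addr_ge0 ?sqr_ge0. Qed.

Lemma absq_eq0 z : (absq z == 0) = (z == 0).
Proof.
by rewrite /absq paddr_eq0 ?sqr_ge0 // !sqrf_eq0 eq_complex.
Qed.

Lemma absq_gt0 z : (0 < absq z) = (z != 0).
Proof. by rewrite lt_def absq_ge0 andbT absq_eq0. Qed.

Lemma absq_normc z : Normc.normc z ^+ 2 = absq z.
Proof. by case: z => a b; rewrite sqr_sqrtr // addr_ge0 ?sqr_ge0. Qed.

Lemma absq_circle (z : circle R) : absq (z : R[i]) = 1.
Proof.
case: z => [[a b]] /=; rewrite normc_def eq_complex /= => /andP[/eqP h _].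
rewrite /absq /= -[RHS](expr1n _ 2) -h sqr_sqrtr // addr_ge0 ?sqr_ge0 //.
Qed.

Lemma conj_circleM (z : circle R) : (z : R[i])^* * z = 1.
Proof. by rewrite -absqE absq_circle. Qed.

Lemma circle_neq0 (z : circle R) : (z : R[i]) != 0.
Proof. by rewrite -absq_eq0 absq_circle oner_eq0. Qed.

Lemma inv_conj_circle (z : circle R) : ((z : R[i])^*)^-1 = z.
Proof.
apply: (mulfI (x := (z : R[i])^*)); last by rewrite conj_circleM divff // conjC_eq0 circle_neq0.
by rewrite conjC_eq0 circle_neq0.
Qed.

End complex_algebra.

(** * Bounded measurable functions on the circle *)

Section circle_borel.
Context {R : realType}.
Implicit Types (g : circle R -> R) (f : circle R -> R[i]).

Lemma open_halfplane_Re (a : R) : open [set z : R[i]^o | a < complex.Re z].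
Proof.
rewrite openE => z /= az.
apply/nbhs_ballP; exists (complex.Re z - a)%:C%C => /=.
  by rewrite ltcR subr_gt0.
move=> u; rewrite /ball /= => zu.
have := le_lt_trans (normc_ge_Re _) zu; rewrite ltcR.
rewrite ReD; case: (u) => c d /= h.
have := le_lt_trans (ler_norm _) h; lra.
Qed.

Lemma open_halfplane_Im (a : R) : open [set z : R[i]^o | a < complex.Im z].
Proof.
rewrite openE => z /= az.
apply/nbhs_ballP; exists (complex.Im z - a)%:C%C => /=.
  by rewrite ltcR subr_gt0.
move=> u; rewrite /ball /= => zu.
have := normc_ge_Re ((z - u) * 'i%C).
rewrite ReiNIm normrN normrM => h1.
have ni : `|'i%C : R[i]| = 1.
  by rewrite normc_def /= expr0n expr1n add0r sqrtr1.
rewrite ni mulr1 in h1.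
have := le_lt_trans h1 zu; rewrite ltcR.
rewrite ImD; case: (u) => c d /= h.
have := le_lt_trans (ler_norm _) h; lra.
Qed.

Lemma measurable_circle_Re : measurable_fun setT (fun z : circle R => complex.Re z).
Proof.
apply: (measurability _ (RGenOInfty.measurableE R)) => _ [_ [a ->] <-].
rewrite setTI; apply: sub_sigma_algebra; exists [set z | a < complex.Re z].
  exact: open_halfplane_Re.
by apply/seteqP; split=> z /=; rewrite in_itv /= andbT.
Qed.

Lemma measurable_circle_Im : measurable_fun setT (fun z : circle R => complex.Im z).
Proof.
apply: (measurability _ (RGenOInfty.measurableE R)) => _ [_ [a ->] <-].
rewrite setTI; apply: sub_sigma_algebra; exists [set z | a < complex.Im z].
  exact: open_halfplane_Im.
by apply/seteqP; split=> z /=; rewrite in_itv /= andbT.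
Qed.

(** It suffices to consider preimages of open sets, and these are open by the
    continuity of cos and sin. *)
Lemma measurable_expi : measurable_fun setT (@expi R).
Proof.
apply: (@measurability _ _ _ _ setT (@expi R) (@circle_open R)) => //.
move=> _ [_ [U oU ->] <-]; rewrite setTI.
apply: open_measurable; rewrite openE => t /= Ut.
move: oU; rewrite openE => /(_ _ Ut) /nbhs_ballP[e /= e0 eU].
have [e1 e2] : 0 < complex.Re e /\ e = (complex.Re e)%:C%C.
  by move: e0; case: (e) => a b; rewrite ltcE /= => /andP[/eqP -> ->].
have h2 : 0 < complex.Re e / 2 by rewrite divr_gt0.
have hc := @continuous_cos R t; have hs := @continuous_sin R t.
move/cvgrPdist_lt : hc => /(_ _ h2) hc.
move/cvgrPdist_lt : hs => /(_ _ h2) hs.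
near=> s; apply: eU; rewrite /ball /= e2 normc_def /= ltcR.
have H1 : `|cos t - cos s| < complex.Re e / 2 by near: s; exact: hc.
have H2 : `|sin t - sin s| < complex.Re e / 2 by near: s; exact: hs.
rewrite -(ger0_norm (ltW e1)) -sqrtr_sqr ltr_sqrt ?exprn_gt0 //.
rewrite -[X in X + _]real_normK ?num_real // -[X in _ + X]real_normK ?num_real //.
have p1 := normr_ge0 (cos t - cos s); have p2 := normr_ge0 (sin t - sin s).
by nra.
Unshelve. all: by end_near. Qed.

(** A class of functions that is closed under sums and products and is
    integrable for every finite measure: the integrability of all the
    polynomial expressions below follows from it. *)
Definition bounded_measurable g :=
  measurable_fun setT g /\ exists M, forall z, `|g z| <= M.

Lemma bmeas_cst (c : R) : bounded_measurable (fun=> c).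
Proof. by split; [exact: measurable_cst|exists `|c|]. Qed.

Lemma bmeas_Re : bounded_measurable (fun z => complex.Re z).
Proof.
split; first exact: measurable_circle_Re.
exists 1 => z; rewrite -lecR (le_trans (normc_ge_Re _)) //.
by rewrite (eqP (circle_norm z)).
Qed.

Lemma bmeas_Im : bounded_measurable (fun z => complex.Im z).
Proof.
split; first exact: measurable_circle_Im.
exists 1 => z; rewrite -[X in _ <= X]sqrtr1 -(absq_circle z) -sqrtr_sqr.
by rewrite ler_wsqrtr // lerDr sqr_ge0.
Qed.

Lemma bmeasD g h : bounded_measurable g -> bounded_measurable h ->
  bounded_measurable (fun z => g z + h z).
Proof.
move=> [mg [M gM]] [mh [N hN]]; split; first exact: measurable_funD.
by exists (M + N) => z; rewrite (le_trans (ler_normD _ _)) // lerD.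
Qed.

Lemma bmeasM g h : bounded_measurable g -> bounded_measurable h ->
  bounded_measurable (fun z => g z * h z).
Proof.
move=> [mg [M gM]] [mh [N hN]]; split; first exact: measurable_funM.
by exists (M * N) => z; rewrite normrM ler_pM.
Qed.

Lemma bmeasN g : bounded_measurable g -> bounded_measurable (fun z => - g z).
Proof.
move=> [mg [M gM]]; split; first exact: measurable_funN.
by exists M => z; rewrite normrN.
Qed.

Lemma bmeas_integrable (mu : {finite_measure set (circle R) -> \bar R}) g :
  bounded_measurable g -> mu.-integrable setT (EFin \o g).
Proof.
move=> [mg [M gM]]; apply: measurable_bounded_integrable => //.
  by rewrite -ge0_fin_numE // fin_num_measure.
exists M; split; first exact: num_real.
by move=> x Mx z _; exact: le_trans (gM z) (ltW Mx).
Qed.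

Definition cbounded_measurable f :=
  bounded_measurable (fun z => complex.Re (f z)) /\
  bounded_measurable (fun z => complex.Im (f z)).

Lemma cbmeas_cst (c : R[i]) : cbounded_measurable (fun=> c).
Proof. by split; exact: bmeas_cst. Qed.

Lemma cbmeas_id : cbounded_measurable (@cval R).
Proof. by split; [exact: bmeas_Re|exact: bmeas_Im]. Qed.

Lemma cbmeasD f h : cbounded_measurable f -> cbounded_measurable h ->
  cbounded_measurable (fun z => f z + h z).
Proof.
move=> [f1 f2] [h1 h2]; split.
  by under eq_fun do rewrite ReD; exact: bmeasD.
by under eq_fun do rewrite ImD; exact: bmeasD.
Qed.

Lemma cbmeasM f h : cbounded_measurable f -> cbounded_measurable h ->
  cbounded_measurable (fun z => f z * h z).
Proof.
move=> [f1 f2] [h1 h2]; split.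
  under eq_fun do rewrite ReM.
  by apply: bmeasD; [exact: bmeasM|apply: bmeasN; exact: bmeasM].
by under eq_fun do rewrite ImM; apply: bmeasD; exact: bmeasM.
Qed.

Lemma cbmeasJ f : cbounded_measurable f -> cbounded_measurable (fun z => (f z)^*).
Proof.
move=> [f1 f2]; split; first by under eq_fun do rewrite ReJ.
by under eq_fun do rewrite ImJ; exact: bmeasN.
Qed.

Lemma cbmeas_horner (P : {poly R[i]}) : cbounded_measurable (fun z => P.[z]).
Proof.
elim/poly_ind: P => [|P c IH].
  by under eq_fun do rewrite horner0; exact: cbmeas_cst.
under eq_fun do rewrite hornerMXaddC.
apply: cbmeasD; last exact: cbmeas_cst.
by apply: cbmeasM => //; exact: cbmeas_id.
Qed.

Lemma bmeas_absq_horner (P : {poly R[i]}) : bounded_measurable (fun z => absq P.[z]).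
Proof.
have [h1 h2] := cbmeas_horner P; rewrite /absq.
by apply: bmeasD; exact: bmeasM.
Qed.

End circle_borel.

(** * The inner product of polynomials *)

Section complex_integral.
Context {R : realType} (mu : {finite_measure set (circle R) -> \bar R}).
Implicit Types f g : circle R -> R[i].

Lemma cintegralD f g : cbounded_measurable f -> cbounded_measurable g ->
  cintegral mu (fun z => f z + g z) = cintegral mu f + cintegral mu g.
Proof.
move=> [f1 f2] [g1 g2]; rewrite /cintegral.
under eq_Rintegral do rewrite ReD.
under [X in (_ +i* X)%C]eq_Rintegral do rewrite ImD.
by rewrite !RintegralD //; exact: bmeas_integrable.
Qed.

Lemma cintegralZ (c : R[i]) f : cbounded_measurable f ->
  cintegral mu (fun z => c * f z) = c * cintegral mu f.
Proof.
move=> [f1 f2]; rewrite /cintegral.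
under eq_Rintegral do rewrite ReM.
under [X in (_ +i* X)%C]eq_Rintegral do rewrite ImM.
have h (a : R) (g : circle R -> R) : bounded_measurable g -> bounded_measurable (fun z => a * g z).
  by move=> bg; apply: bmeasM => //; exact: bmeas_cst.
rewrite RintegralB ?RintegralD //; try by apply: bmeas_integrable; exact: h.
rewrite !RintegralZl //; try exact: bmeas_integrable.
by case: c.
Qed.

Lemma cintegralJ f : cbounded_measurable f ->
  cintegral mu (fun z => (f z)^*) = (cintegral mu f)^*.
Proof.
move=> [f1 f2]; apply: complex_ext; rewrite ?ReJ ?ImJ /=.
  by under eq_Rintegral do rewrite ReJ.
under eq_Rintegral do rewrite ImJ -mulN1r.
by rewrite RintegralZl ?mulN1r //; exact: bmeas_integrable.
Qed.

Lemma eq_cintegral f g : f =1 g -> cintegral mu f = cintegral mu g.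
Proof. by move=> /funext ->. Qed.

End complex_integral.

Section inner_product.
Context {R : realType} (mu : {finite_measure set (circle R) -> \bar R}).
Implicit Types (P Q S : {poly R[i]}) (c : R[i]).

Definition ip P Q : R[i] := cintegral mu (fun z => (P.[z])^* * Q.[z]).

Definition sqnorm P : R := \int[mu]_z absq P.[z].

Lemma cbmeas_ip P Q : cbounded_measurable (fun z : circle R => (P.[z])^* * Q.[z]).
Proof. by apply: cbmeasM; [apply: cbmeasJ|]; exact: cbmeas_horner. Qed.

Lemma ipC P Q : (ip P Q)^* = ip Q P.
Proof.
rewrite /ip -cintegralJ; last exact: cbmeas_ip.
by apply: eq_cintegral => z; rewrite rmorphM /= conjCK mulrC.
Qed.

Lemma ipDr P Q S : ip P (Q + S) = ip P Q + ip P S.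
Proof.
rewrite /ip -cintegralD; [|exact: cbmeas_ip..].
by apply: eq_cintegral => z; rewrite hornerD mulrDr.
Qed.

Lemma ipZr P Q c : ip P (c *: Q) = c * ip P Q.
Proof.
rewrite /ip -cintegralZ; last exact: cbmeas_ip.
by apply: eq_cintegral => z; rewrite hornerZ mulrCA.
Qed.

Lemma ipDl P Q S : ip (P + Q) S = ip P S + ip Q S.
Proof. by rewrite -ipC ipDr rmorphD /= !ipC. Qed.

Lemma ipZl P Q c : ip (c *: P) Q = c^* * ip P Q.
Proof. by rewrite -ipC ipZr rmorphM /= ipC. Qed.

Lemma ip0l P : ip 0 P = 0.
Proof. by rewrite -(scale0r 0) ipZl conjC0 mul0r. Qed.

Lemma ipBr P Q S : ip P (Q - S) = ip P Q - ip P S.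
Proof. by rewrite -scaleN1r ipDr ipZr mulN1r. Qed.

Lemma ipBl P Q S : ip (P - Q) S = ip P S - ip Q S.
Proof. by rewrite -ipC ipBr rmorphB /= !ipC. Qed.

(** Multiplication by z is an isometry since |z| = 1. *)
Lemma ip_mulX P Q : ip ('X * P) ('X * Q) = ip P Q.
Proof.
apply: eq_cintegral => z; rewrite !hornerM hornerX rmorphM /= mulrACA.
by rewrite conj_circleM mul1r.
Qed.

Lemma size_rev_poly n P : (size (rev_poly n P) <= n.+1)%N.
Proof. exact: size_poly. Qed.

(** On the circle the reversal of P is z^n times the conjugate of P. *)
Lemma ip_rev n P Q : (size P <= n.+1)%N -> (size Q <= n.+1)%N ->
  ip (rev_poly n P) (rev_poly n Q) = ip Q P.
Proof.
move=> sP sQ; apply: eq_cintegral => z.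
rewrite !horner_rev_poly ?circle_neq0 // inv_conj_circle rmorphM /= conjCK mulrACA.
by rewrite rmorphXn /= -exprMn conj_circleM expr1n mul1r mulrC.
Qed.

Lemma ip_sqnorm P : ip P P = (sqnorm P)%:C%C.
Proof.
rewrite /ip; under eq_cintegral do rewrite -absqE.
by apply: complex_ext => //=; rewrite Rintegral_cst // mul0r.
Qed.

Lemma sqnormE P : sqnorm P = complex.Re (ip P P).
Proof. by rewrite ip_sqnorm. Qed.

Lemma sqnormD_orth P Q : ip P Q = 0 -> sqnorm (P + Q) = sqnorm P + sqnorm Q.
Proof.
move=> PQ0; rewrite !sqnormE ipDr !ipDl PQ0 -[ip Q P]ipC PQ0 conjC0 addr0 add0r.
by rewrite ReD.
Qed.

Lemma sqnormZ P c : sqnorm (c *: P) = absq c * sqnorm P.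
Proof.
rewrite sqnormE ipZl ipZr mulrA -absqE ip_sqnorm ReM /=.
by rewrite mul0r subr0.
Qed.

Lemma sqnorm_mulX P : sqnorm ('X * P) = sqnorm P.
Proof. by rewrite !sqnormE ip_mulX. Qed.

Lemma sqnorm_rev n P : (size P <= n.+1)%N -> sqnorm (rev_poly n P) = sqnorm P.
Proof. by move=> sP; rewrite !sqnormE ip_rev. Qed.

(** With [ip_rev], this turns the orthogonality of P to 1, ..., z^(n-1) into the
    orthogonality of its reversal to z, ..., z^n. *)
Lemma rev_polyXn n k : (k <= n)%N -> rev_poly n 'X^(n - k) = 'X^k :> {poly R[i]}.
Proof.
move=> kn; apply/polyP => i; rewrite coef_poly !coefXn.
case: ltnP => [|ni]; last by rewrite gtn_eqF // (leq_ltn_trans kn).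
rewrite ltnS => i_n; rewrite eqn_sub2lE //.
by case: eqP => _; rewrite ?rmorph1 ?rmorph0.
Qed.

End inner_product.

(** * Monic orthogonal polynomials *)

Section szego_recursion.
Context {R : realType} (mu : {finite_measure set (circle R) -> \bar R}).
Context (sqnorm_gt0 : forall P : {poly R[i]}, P != 0 -> 0 < sqnorm mu P).
Implicit Types (P Q S : {poly R[i]}) (n : nat).

Lemma is_monic_OP_ipX n P k : is_monic_OP mu n P -> (k < n)%N -> ip mu 'X^k P = 0.
Proof.
by case=> _ _ H kn; rewrite /ip -(H k kn); apply: eq_cintegral => z; rewrite hornerXn.
Qed.

Lemma is_monic_OP_orth n P Q : is_monic_OP mu n P -> (size Q <= n)%N -> ip mu Q P = 0.
Proof.
move=> opP sQ; rewrite -[Q]coefK poly_def.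
apply: (big_ind (fun S => ip mu S P = 0)).
- exact: ip0l.
- by move=> S T S0 T0; rewrite ipDl S0 T0 addr0.
move=> i _; rewrite ipZl (is_monic_OP_ipX opP) ?mulr0 //.
exact: leq_trans (ltn_ord i) sQ.
Qed.

Lemma size_monic_sub n P Q : P \is monic -> Q \is monic ->
  size P = n.+1 -> size Q = n.+1 -> (size (P - Q)%R <= n)%N.
Proof.
move=> /monicP mP /monicP mQ sP sQ; apply/leq_sizeP => j.
rewrite coefB leq_eqVlt => /predU1P[<-|nj].
  by move: mP mQ; rewrite !lead_coefE sP sQ /= => -> ->; rewrite subrr.
by rewrite !nth_default ?sP ?sQ // subrr.
Qed.

(** The difference of two candidates has degree less than n, so it is
    orthogonal to both of them, hence to itself. *)
Lemma is_monic_OP_uniq n P Q : is_monic_OP mu n P -> is_monic_OP mu n Q -> P = Q.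
Proof.
move=> opP opQ; apply/eqP; rewrite -subr_eq0.
have sPQ : (size (P - Q)%R <= n)%N.
  by case: opP opQ => [? ? _] [? ? _]; exact: size_monic_sub.
apply: contraT => /sqnorm_gt0.
by rewrite sqnormE ipBr !(is_monic_OP_orth _ sPQ) // subrr ltxx.
Qed.

(** P - z^n has degree less than n, hence is orthogonal to P. *)
Lemma ip_monic_OP n P : is_monic_OP mu n P -> ip mu 'X^n P = (sqnorm mu P)%:C%C.
Proof.
move=> opP; case: (opP) => mP sP _.
apply/eqP; rewrite eq_sym -subr_eq0 -ip_sqnorm -ipBl; apply/eqP.
apply: is_monic_OP_orth (opP) _.
by apply: size_monic_sub; rewrite ?monicXn ?size_polyXn.
Qed.

(** Both z P and the reversal of P are orthogonal to z, ..., z^n; the inner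
    product of 1 with the reversal is the squared norm of P, which is nonzero,
    so a suitable coefficient makes the combination orthogonal to 1 as well. *)
Lemma szego_step n P : is_monic_OP mu n P ->
  exists a : R[i], is_monic_OP mu n.+1 ('X * P - (a^*)%:P * rev_poly n P).
Proof.
move=> opP; case: (opP) => mP sP _.
have P0 : P != 0 by rewrite -size_poly_gt0 sP.
have N0 := sqnorm_gt0 P0.
exists ((ip mu 1 ('X * P) / (sqnorm mu P)%:C%C)^*); rewrite conjCK.
set c := _ / _.
have sXP : size ('X * P) = n.+2 by rewrite mulrC size_mulX // sP.
have sR : (size (- (c%:P * rev_poly n P)) < size ('X * P)%R)%N.
  rewrite size_polyN mul_polyC sXP ltnS; apply: leq_trans (size_scale_leq _ _) _.
  exact: size_rev_poly.
split.
- by rewrite monicE lead_coefDl // -monicE monicMr // monicX.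
- by rewrite size_polyDl.
move=> k; rewrite ltnS => kn.
transitivity (ip mu 'X^k ('X * P - c%:P * rev_poly n P)).
  by apply: eq_cintegral => z; rewrite hornerXn.
rewrite ipBr mul_polyC ipZr -{2}(@rev_polyXn R n k kn) ip_rev ?sP ?size_polyXn ?ltnS ?leq_subr //.
case: k kn => [|k] kn.
  have cJ : ((sqnorm mu P)%:C%C)^* = (sqnorm mu P)%:C%C :> R[i].
    by apply: complex_ext; rewrite ?ReJ ?ImJ //= oppr0.
  rewrite subn0 -[ip mu P _]ipC (ip_monic_OP opP) expr0 cJ /c divfK ?subrr //.
  by apply/eqP => -[/eqP]; rewrite gt_eqF.
rewrite exprS ip_mulX (is_monic_OP_ipX opP) // -[ip mu P _]ipC.
rewrite (is_monic_OP_ipX opP) ?conjC0 ?mulr0 ?subrr //.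
by rewrite ltn_subrL (leq_ltn_trans _ kn).
Qed.

Lemma is_monic_OP_ex n : exists P, is_monic_OP mu n P.
Proof.
elim: n => [|n [P /szego_step[a opP]]]; last by eexists; exact: opP.
by exists 1; split; rewrite ?monic1 ?size_poly1.
Qed.

Lemma monic_OPP n : is_monic_OP mu n (monic_OP mu n).
Proof. exact: (xgetPex 0 (is_monic_OP_ex n)). Qed.

Lemma verblunskyP n : monic_OP mu n.+1 =
  'X * monic_OP mu n - ((verblunsky mu n)^*)%:P * rev_poly n (monic_OP mu n).
Proof.
apply: (@xgetPex _ 0 [set a : R[i] | monic_OP mu n.+1 =
  'X * monic_OP mu n - (a^*)%:P * rev_poly n (monic_OP mu n)]).
have [a opa] := szego_step (monic_OPP n).
by exists a; exact: is_monic_OP_uniq (monic_OPP n.+1) opa.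
Qed.

Lemma monic_OP_neq0 n : monic_OP mu n != 0.
Proof. by case: (monic_OPP n) => /monic_neq0. Qed.

(** Pythagoras: z Phi_n is the sum of Phi_(n+1) and a multiple of the reversal
    of Phi_n, which has degree at most n and the same norm as Phi_n. *)
Lemma sqnorm_monic_OPS n : sqnorm mu (monic_OP mu n.+1) =
  (1 - absq (verblunsky mu n)) * sqnorm mu (monic_OP mu n).
Proof.
have [_ sP _] := monic_OPP n.
have e : 'X * monic_OP mu n = ((verblunsky mu n)^*) *: rev_poly n (monic_OP mu n) + monic_OP mu n.+1.
  by rewrite verblunskyP mul_polyC addrC subrK.
have := sqnorm_mulX mu (monic_OP mu n); rewrite e sqnormD_orth.
  rewrite sqnormZ sqnorm_rev ?sP // absqJ => h.
  by rewrite mulrBl mul1r -[X in X - _]h addrC addKr.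
apply: is_monic_OP_orth (monic_OPP n.+1) _.
by apply: leq_trans (size_scale_leq _ _) _; exact: size_rev_poly.
Qed.

Lemma sqnorm_monic_OP_gt0 n : 0 < sqnorm mu (monic_OP mu n).
Proof. exact: sqnorm_gt0 (monic_OP_neq0 n). Qed.

Lemma rho_sqnorm n : rho mu n =
  Num.sqrt (sqnorm mu (monic_OP mu n.+1) / sqnorm mu (monic_OP mu n)).
Proof.
rewrite sqnorm_monic_OPS mulfK ?gt_eqF ?sqnorm_monic_OP_gt0 //.
by rewrite /rho absq_normc.
Qed.

Lemma sqnorm_monic_OP_decr n :
  sqnorm mu (monic_OP mu n.+1) <= sqnorm mu (monic_OP mu n).
Proof.
rewrite sqnorm_monic_OPS ler_piMl ?(ltW (sqnorm_monic_OP_gt0 n)) //.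
by rewrite lerBlDr lerDl absq_ge0.
Qed.

Lemma prod_rho n : \prod_(1 <= k < n.+1) rho mu k =
  Num.sqrt (sqnorm mu (monic_OP mu n.+1) / sqnorm mu (monic_OP mu 1)).
Proof.
have N0 k := sqnorm_monic_OP_gt0 k.
elim: n => [|n IH]; first by rewrite big_geq // divff ?gt_eqF // sqrtr1.
rewrite big_nat_recr //= IH rho_sqnorm -sqrtrM ?divr_ge0 ?ltW //.
by rewrite mulrC mulrA divfK ?gt_eqF.
Qed.

(** If Phi_n = (z - a) Q, then z Q = a Q + Phi_n is an orthogonal sum, so
    ||Q||^2 = |a|^2 ||Q||^2 + ||Phi_n||^2 with ||Phi_n|| > 0. *)
Lemma root_monic_OP n (a : R[i]) : root (monic_OP mu n) a -> absq a < 1.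
Proof.
move=> /factor_theorem[Q Pe].
have [_ sP _] := monic_OPP n.
have Q0 : Q != 0.
  by apply: contraTneq (monic_OP_neq0 n) => Q0; rewrite Pe Q0 mul0r eqxx.
have sQ : (size Q <= n)%N.
  by move: sP; rewrite Pe size_Mmonic ?monicXsubC // size_XsubC addn2 => -[<-].
have e : 'X * Q = a *: Q + monic_OP mu n by rewrite Pe -mul_polyC; ring.
have := sqnorm_mulX mu Q; rewrite e sqnormD_orth.
  rewrite sqnormZ => h; have := sqnorm_gt0 Q0; have := sqnorm_monic_OP_gt0 n => h1 h2.
  by rewrite -(ltr_pM2r h2) mul1r -[X in _ < X]h ltrDl.
apply: is_monic_OP_orth (monic_OPP n) _.
exact: leq_trans (size_scale_leq _ _) sQ.
Qed.

End szego_recursion.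

(** * Comparison with Lebesgue measure *)

Section lebesgue_domination.
Context {R : realType}.
Notation leb := (@lebesgue_measure R).

(** If cos (t - s) = 1, then the sine of (t - s) / 2, which lies strictly
    between 0 and pi, would vanish. *)
Lemma expi_inj : {in `[0, pi *+ 2[ &, injective (@expi R)}.
Proof.
suff H (s t : R) : 0 <= s -> s < t -> t < pi *+ 2 -> expi s != expi t.
  move=> s t; rewrite !in_itv /= => /andP[s0 s2] /andP[t0 t2].
  by case: (ltgtP s t) => // [st|ts] e;
    [have := H _ _ s0 st t2|have := H _ _ t0 ts s2]; rewrite e eqxx.
move=> s0 st t2; apply/eqP => /(congr1 (@cval R)) [ec es].
have h : 0 < (t - s) / 2 < pi by rewrite mulr2n in t2; lra.
have sp := sin_gt0_pi h; have : cos (((t - s) / 2) *+ 2) = 1.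
  have -> : ((t - s) / 2) *+ 2 = t - s by rewrite mulr2n; lra.
  by rewrite cosB ec es -!expr2 cos2Dsin2.
have := cos2Dsin2 ((t - s) / 2); rewrite cos_mulr2n mulr2n => h1 h2.
have : sin ((t - s) / 2) ^+ 2 = 0 by lra.
by move=> /eqP; rewrite sqrf_eq0 gt_eqF.
Qed.

Lemma countable_roots_expi (P : {poly R[i]}) : P != 0 ->
  countable (`[0, pi *+ 2[%classic `&` [set t : R | P.[expi t] = 0]).
Proof.
move=> P0; have [r Pr] := closed_field_poly_normal P.
apply: finite_set_countable.
set A := _ `&` _.
have inj : {in A &, injective (fun t => (expi t : R[i]))}.
  by move=> s t /set_mem[s0 _] /set_mem[t0 _] /val_inj /expi_inj; exact.
rewrite -(eq_finite_set (inj_card_eq inj)).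
apply: sub_finite_set (finite_seq r) => _ [t [_ /= Pt] <-].
have : root P (expi t) by apply/rootP.
by rewrite {1}Pr rootZ ?lead_coef_eq0 // root_prod_XsubC.
Qed.

Context (mu : {finite_measure set (circle R) -> \bar R})
    (mu_s : {measure set (circle R) -> \bar R}) (w : R -> R)
    (w_meas : measurable_fun `[0, pi *+ 2[ w)
    (w_pos : {ae leb, forall t : R, t \in `[0, pi *+ 2[ -> 0 < w t})
    (mu_decomp : forall A : set (circle R), measurable A ->
       mu A = (\int[lebesgue_measure]_(t in `[0%R, (pi *+ 2)%R[ `&` @expi R @^-1` A)
                 (w t / (pi *+ 2))%R%:E + mu_s A)%E).

Definition density_ge (d : R) : set R := `[0, pi *+ 2[ `&` [set t | d <= w t].

Lemma measurable_density_ge d : measurable (density_ge d).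
Proof.
have -> : density_ge d = `[0, pi *+ 2[ `&` w @^-1` `[d, +oo[.
  by apply/seteqP; split=> t [t0 /= h]; split => //; move: h; rewrite /= in_itv /= andbT.
exact: w_meas.
Qed.

Lemma measurable_expi_preimage (B : set (circle R)) : measurable B ->
  measurable (@expi R @^-1` B).
Proof. by move=> mB; rewrite -[X in measurable X]setTI; exact: measurable_expi. Qed.

(** The singular part only adds mass, and w >= 0 almost everywhere while w >= d
    on the set in question.  Negative values of w on a null set are removed by
    passing to max(w, 0). *)
Lemma density_ge_domination d (B : set (circle R)) : 0 < d -> measurable B ->
  ((d / (pi *+ 2))%:E * leb (@expi R @^-1` B `&` density_ge d) <= mu B)%E.
Proof.
move=> d0 mB; rewrite mu_decomp //.
have pi2 : 0 < pi *+ 2 :> R by rewrite mulrn_wgt0 ?pi_gt0.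
set E := _ `&` _ @^-1` _.
have mE : measurable E by apply: measurableI => //; exact: measurable_expi_preimage.
have mw : measurable_fun E w by apply: measurable_funS w_meas => // t [].
have mwE : measurable_fun E (fun t => (w t / (pi *+ 2))%:E).
  by apply/measurable_EFinP; apply: measurable_funM.
apply: (@le_trans _ _ (\int[leb]_(t in E) (w t / (pi *+ 2))%R%:E)%E); last first.
  by rewrite leeDl.
have mA := measurable_density_ge d.
rewrite (@ae_eq_integral _ _ _ leb E (fun t => (Num.max (w t) 0 / (pi *+ 2))%:E)) //.
- rewrite [X in leb X](_ : _ = density_ge d `&` E); last first.
    by apply/seteqP; split=> t [h1 [h2 h3]]; split.
  have mi : measurable_fun E (fun t => (\1_(density_ge d) t)%:E : \bar R).
    by apply/measurable_EFinP; exact: measurable_indic.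
  rewrite -integral_indic // -ge0_integralZl_EFin //; last first.
    by rewrite divr_ge0 ?ltW.
  have m0 t : 0 <= Num.max (w t) 0 / (pi *+ 2).
    by rewrite divr_ge0 ?(ltW pi2) // le_max lexx orbT.
  apply: ge0_le_integral => //.
  - by move=> t _; rewrite -EFinM lee_fin mulr_ge0 // divr_ge0 ?ltW.
  - exact: measurable_funeM.
  - by apply/measurable_EFinP; apply: measurable_funM => //; apply: measurable_maxr.
  move=> t _; rewrite -EFinM lee_fin indicE.
  case: (boolP (t \in _)) => [/set_mem[_ /= dw]|_]; last by rewrite mulr0.
  by rewrite mulr1 ler_pM2r ?invr_gt0 // le_max dw.
- by apply/measurable_EFinP; apply: measurable_funM => //; apply: measurable_maxr.
move: w_pos; apply: filterS; first exact: (ae_filter_ringOfSetsType leb).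
move=> t h [/h wt _]; congr (_ / _)%:E.
by rewrite max_l // ltW.
Qed.

(** [density_ge_domination] compares mu with the image under e^(it) of a
    multiple of restricted Lebesgue measure; integration preserves this
    comparison. *)
Lemma density_ge_le_integral d (f : circle R -> R) : 0 < d ->
  measurable_fun setT f -> (forall z, 0 <= f z) ->
  ((d / (pi *+ 2))%:E * \int[leb]_(t in density_ge d) (f (expi t))%:E
    <= \int[mu]_z (f z)%:E)%E.
Proof.
move=> d0 mf f0; have mA := measurable_density_ge d.
have k0 : 0 <= d / (pi *+ 2) by apply: divr_ge0; [exact: ltW|apply: mulrn_wge0; exact: pi_ge0].
have mfe : measurable_fun setT (fun z => (f z)%:E : \bar R) by exact/measurable_EFinP.
have mft : measurable_fun setT (fun t : R => (f (expi t))%:E : \bar R).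
  by apply/measurable_EFinP; apply: measurableT_comp => //; exact: measurable_expi.
pose rest : {measure set (g_sigma_algebraType (R.-ocitv.-measurable)) -> \bar R} := mrestr leb mA.
pose push : {measure set (circle R) -> \bar R} := 
  measure_function_pushforward__canonical__measure_function_Measure rest measurable_expi.
pose scaled : {measure set (circle R) -> \bar R} := mscale (NngNum k0) push.
apply: (@le_trans _ _ (\int[scaled]_z (f z)%:E)%E); last first.
  apply: ge0_le_measure_integral => //.
  by move=> B mB; exact: density_ge_domination.
rewrite ge0_integral_mscale //; last by move=> z _; rewrite lee_fin.
apply: lee_wpmul2l; first by rewrite lee_fin.
rewrite (@ge0_integral_pushforward _ _ (g_sigma_algebraType R.-ocitv.-measurable)
  _ _ _ measurable_expi rest) //; last first.
  by move=> z _; rewrite lee_fin.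
rewrite preimage_setT /comp.
apply: (@le_trans _ _ (\int[rest]_(t in density_ge d) (f (expi t))%:E)%E).
  rewrite le_eqVlt; apply/orP; left; apply/eqP; apply: eq_measure_integral => S mS SA.
  by rewrite /rest /= /mrestr (setIidl SA).
apply: ge0_subset_integral => //.
by move=> t _; rewrite lee_fin.
Qed.

Lemma leb_circle_itv : leb `[0, pi *+ 2[ = (pi *+ 2)%:E.
Proof. by rewrite lebesgue_measure_itv /= lte_fin mulrn_wgt0 ?pi_gt0 // oppr0 addr0. Qed.

(** The sets where w < 1 / (n + 1) decrease to the null set where w <= 0. *)
Lemma density_ge_complement (e : R) : 0 < e ->
  exists2 d, 0 < d & (leb (`[0%R, (pi *+ 2)%R[ `\` density_ge d) < e%:E)%E.
Proof.
move=> e0; pose F n := `[0, pi *+ 2[%classic `\` density_ge n.+1%:R^-1.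
have mF n : measurable (F n) by apply: measurableD => //; exact: measurable_density_ge.
have mI : measurable (\bigcap_n F n) by exact: bigcapT_measurable.
have nF : nonincreasing_seq F.
  move=> m n mn; apply/subsetPset => t [t0 nA]; split => // -[_ /= h]; apply: nA.
  by split => //=; apply: le_trans h; rewrite lef_pV2 ?posrE ?ltr0n // ler_nat.
have I0 : leb (\bigcap_n F n) = 0%E.
  apply/negligibleP => //; move: w_pos => [N [mN N0 wN]]; exists N; split => //.
  move=> t Ft; apply: wN => /= h; have [t0 _] := Ft 0%N I.
  have /(_ _)wt := h _; have {}wt : 0 < w t by apply: wt.
  pose n := Num.truncn (w t)^-1.
  have [_] := Ft n I; apply; split => //=.
  rewrite -[leRHS]invrK lef_pV2 ?posrE ?ltr0n ?invr_gt0 //.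
  by apply: ltW; rewrite truncnS_gt.
have F0 : (leb (F 0%N) < +oo)%E.
  apply: (@le_lt_trans _ _ (leb `[0%R, (pi *+ 2)%R[)); last by rewrite leb_circle_itv ltry.
  apply: le_measure; last by move=> t [].
    by apply: mem_set; exact: mF.
  by apply: mem_set; exact: measurable_itv.
have cF : (leb \o F) @ \oo --> 0%E.
  by rewrite -I0; exact: nonincreasing_cvg_mu F0 mF mI nF.
have : \forall n \near \oo, (leb (F n) < e%:E)%E.
  apply: (cF [set y | (y < e%:E)%E]); apply: open_nbhs_nbhs; split => /=.
    exact: open_ereal_lt_ereal.
  by rewrite lte_fin.
move=> [n _ /(_ n (leqnn n)) h]; exists n.+1%:R^-1 => //.
Qed.

End lebesgue_domination.

(** * The logarithmic mean of an orthogonal polynomial *)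

Section log_mean_poly.
Context {R : realType}.
Notation leb := (@lebesgue_measure R).

Lemma absq_expi_sub (t : R) (a : R[i]) :
  absq ((expi t : R[i]) - a) = chord2 (complex.Re a) (complex.Im a) t.
Proof.
case: a => x y; rewrite /absq /chord2 /=.
transitivity (cos t ^+ 2 + sin t ^+ 2 - 2 * (x * cos t + y * sin t) + (x ^+ 2 + y ^+ 2)).
  by ring.
by rewrite cos2Dsin2.
Qed.

(** The parallelogram law gives |z - a|^2 <= 2 |z|^2 + 2 |a|^2. *)
Lemma absq_sub_le4 (z : circle R) (a : R[i]) : absq a < 1 -> absq ((z : R[i]) - a) <= 4.
Proof.
move=> a1; have := absq_circle z; move: a1.
case: (z : R[i]) => c s; case: a => x y; rewrite /absq /= => xy cs.
have -> : (c - x) ^+ 2 + (s - y) ^+ 2 = 2 * (c ^+ 2 + s ^+ 2) +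
    2 * (x ^+ 2 + y ^+ 2) - ((c + x) ^+ 2 + (s + y) ^+ 2) by ring.
have : 0 <= (c + x) ^+ 2 + (s + y) ^+ 2 by rewrite addr_ge0 ?sqr_ge0.
rewrite cs; set u := _ + _ => u0; clearbody u.
by move: xy; set v := _ + _ => xy; clearbody v; lra.
Qed.

(** The logarithm turns the product into a sum of [chord2] terms, each with
    nonnegative mean; no logarithm is singular since the roots are off the
    circle. *)
Lemma log_prod_XsubC (r : seq R[i]) : (forall a, a \in r -> absq a < 1) ->
  let P := \prod_(a <- r) ('X - a%:P) in
  [/\ forall z : circle R, 0 < absq P.[z] <= 4 ^+ size r,
      continuous (fun t => ln (absq P.[expi t])) &
      0 <= \int[leb]_(t in `[0, pi *+ 2]) ln (absq P.[expi t])].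
Proof.
elim: r => [_|a r IH ar] /=.
  rewrite big_nil; have e t : ln (absq (1 : {poly R[i]}).[expi t]) = 0 :> R.
    by rewrite hornerC absq1 ln1.
  split.
  - by move=> z; rewrite hornerC absq1 ltr01 expr0 lexx.
  - by under eq_fun do rewrite e; move=> t; exact: cvg_cst.
  - by under eq_Rintegral do rewrite e; rewrite Rintegral_cst ?mul0r.
have [|/= IH1 IH2 IH3] := IH; first by move=> b br; rewrite ar // inE br orbT.
rewrite big_cons; set P := \prod_(b <- r) _ in IH1 IH2 IH3 *.
have a1 : complex.Re a ^+ 2 + complex.Im a ^+ 2 < 1 by apply: ar; rewrite mem_head.
have azP z : absq (('X - a%:P) * P).[z] = absq (z - a) * absq P.[z].
  by rewrite hornerM absqM hornerXsubC.
have cont := continuous_ln_chord2 a1.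
have e t : ln (absq (('X - a%:P) * P).[expi t]) =
    ln (chord2 (complex.Re a) (complex.Im a) t) + ln (absq P.[expi t]).
  have /andP[P0 _] := IH1 (expi t).
  by rewrite azP lnM ?posrE // ?absq_expi_sub // chord2_gt0.
split.
- move=> z; have /andP[P0 P4] := IH1 z; rewrite azP.
  have z0 : (z : R[i]) - a != 0.
    by apply: contraTneq a1 => /subr0_eq <-; rewrite -/(absq _) absq_circle ltxx.
  apply/andP; split; first by apply: mulr_gt0 => //; rewrite absq_gt0.
  by rewrite exprS ler_pM ?absq_ge0 // absq_sub_le4.
- by under eq_fun do rewrite e; move=> t; apply: cvgD; [exact: cont|exact: IH2].
under eq_Rintegral do rewrite e.
rewrite RintegralD //; [|exact: continuous_itv_integrable cont|exact: continuous_itv_integrable].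
by rewrite addr_ge0 // log_chord2_ge0.
Qed.

End log_mean_poly.

Section erdos_turan.
Context {R : realType}.
Notation leb := (@lebesgue_measure R).
Context (mu : {finite_measure set (circle R) -> \bar R})
    (mu_s : {measure set (circle R) -> \bar R}) (w : R -> R)
    (w_meas : measurable_fun `[0, pi *+ 2[ w)
    (w_pos : {ae leb, forall t : R, t \in `[0, pi *+ 2[ -> 0 < w t})
    (mu_decomp : forall A : set (circle R), measurable A ->
       mu A = (\int[lebesgue_measure]_(t in `[0%R, (pi *+ 2)%R[ `&` @expi R @^-1` A)
                 (w t / (pi *+ 2))%R%:E + mu_s A)%E).

Lemma sqnormEFin (P : {poly R[i]}) : ((sqnorm mu P)%:E = \int[mu]_z (absq P.[z])%:E)%E.
Proof.
rewrite fineK // -[X in X \is a fin_num]/(\int[mu]_z (EFin \o (fun z : circle R => absq P.[z])) z)%E.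
by apply: integrable_fin_num => //; apply: bmeas_integrable; exact: bmeas_absq_horner.
Qed.

Lemma density_ge_sqnorm d (P : {poly R[i]}) : 0 < d ->
  (\int[leb]_(t in density_ge w d) (absq P.[expi t])%:E
    <= ((pi *+ 2) / d * sqnorm mu P)%:E)%E.
Proof.
move=> d0; have p2 : 0 < pi *+ 2 :> R by rewrite mulrn_wgt0 ?pi_gt0.
have := @density_ge_le_integral R mu mu_s w w_meas w_pos mu_decomp d (fun z => absq P.[z]) d0 _ _.
rewrite -sqnormEFin => /(_ (bmeas_absq_horner P).1 (fun z => absq_ge0 _)).
have k0 : 0 < d / (pi *+ 2) by rewrite divr_gt0.
move=> h; rewrite EFinM -[(pi *+ 2) / d]invf_div.
by rewrite (@lee_pdivlMl _ (d / (pi *+ 2))).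
Qed.

(** If P had norm 0, it would vanish almost everywhere on a set where w >= d,
    of positive Lebesgue measure for small d; but P has finitely many zeros. *)
Lemma sqnorm_gt0 (P : {poly R[i]}) : P != 0 -> 0 < sqnorm mu P.
Proof.
move=> P0; rewrite lt_def Rintegral_ge0 ?andbT; last by move=> z _; exact: absq_ge0.
apply/eqP => N0.
have [d d0 hd] := density_ge_complement w_meas w_pos (e := pi *+ 2) (mulrn_wgt0 _ (pi_gt0 R)).
have mA := measurable_density_ge w_meas d.
have mf : measurable_fun (density_ge w d) (fun t : R => (absq P.[expi t])%:E : \bar R).
  apply/measurable_EFinP; apply: measurable_funTS.
  have [mP _] := bmeas_absq_horner P.
  exact: measurableT_comp mP measurable_expi.
have := density_ge_sqnorm P d0; rewrite N0 mulr0 => h.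
have {}h : (\int[leb]_(t in density_ge w d) `|(absq P.[expi t])%:E| = 0)%E.
  apply/eqP; rewrite eq_le integral_ge0 // andbT; apply: le_trans h.
  rewrite le_eqVlt; apply/orP; left; apply/eqP; apply: eq_integral => t _.
  by rewrite gee0_abs // lee_fin absq_ge0.
have [N [mN N0' AN]] := (ae_eq_integral_abs leb mA mf).1 h.
pose Z := `[0, pi *+ 2[%classic `&` [set t : R | P.[expi t] = 0].
have Z0 : leb Z = 0%E by apply: countable_lebesgue_measure0; exact: countable_roots_expi.
have mZ : measurable Z.
  apply: countable_measurable; first by move=> t; exact: measurable_set1.
  exact: countable_roots_expi.
have mD : measurable (`[0, pi *+ 2[%classic `\` density_ge w d) by exact: measurableD.
move: hd; apply/negP; rewrite -leNgt -leb_circle_itv.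
apply: (@le_trans _ _ (leb ((`[0, pi *+ 2[%classic `\` density_ge w d) `|` (N `|` Z)))).
  apply: le_measure; [by apply: mem_set; exact: measurable_itv| |].
    by apply: mem_set; exact: (measurableU _ _ mD (measurableU _ _ mN mZ)).
  move=> t t0; case: (pselect (density_ge w d t)) => [At|]; last by left.
  right; case: (pselect (P.[expi t] = 0)) => Pt; first by right.
  left; apply: AN => /= /(_ At) [/eqP]; rewrite absq_eq0 => /eqP.
  exact: Pt.
apply: le_trans (@measureU2 _ _ _ leb _ _ mD (measurableU _ _ mN mZ)) _.
rewrite -[leRHS]adde0; apply: leeD2l.
apply: le_trans (@measureU2 _ _ _ leb _ _ mN mZ) _.
rewrite -[leRHS]adde0; apply: leeD; rewrite le_eqVlt; apply/orP; left; apply/eqP.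
  exact: N0'.
exact: Z0.
Qed.

(** The mean of ln |Phi_n|^2 is nonnegative.  It is split over the set where
    w >= d, where ln y <= ln N + y / N applies with N the squared norm, and the
    rest of the period, where |Phi_n|^2 <= 4^n. *)
Lemma log_sqnorm_lower d n : 0 < d ->
  0 <= fine (leb (density_ge w d)) * ln (sqnorm mu (monic_OP mu n)) + pi *+ 2 / d +
    fine (leb (`[0, pi *+ 2[%classic `\` density_ge w d)) * (n%:R * ln 4).
Proof.
move=> d0; set A := density_ge w d; set B := _ `\` A.
have mA : measurable A := measurable_density_ge w_meas d.
have mB : measurable B by exact: measurableD.
have opP := monic_OPP sqnorm_gt0 n.
have Ngt := sqnorm_monic_OP_gt0 sqnorm_gt0 n.
set N := sqnorm mu _ in Ngt *.
set P := monic_OP mu n in opP N Ngt *.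
have [mP sP _] := opP.
have [r Pr] := closed_field_poly_normal P.
rewrite (monicP mP) scale1r in Pr.
have sr : size r = n by move: sP; rewrite Pr size_prod_XsubC => -[].
have [|] := @log_prod_XsubC _ r.
  by move=> a ar; apply: (root_monic_OP sqnorm_gt0 (n := n)); rewrite -/P Pr root_prod_XsubC.
rewrite -Pr sr => H1 H2 H3.
pose f t := ln (absq P.[expi t]).
have ecf : continuous (fun t => absq P.[expi t]).
  (* continuity of |Phi_n|^2 follows from that of its logarithm *)
  have -> : (fun t => absq P.[expi t]) = expR \o f.
    by apply/funext => t; rewrite /= lnK // posrE; case/andP: (H1 (expi t)).
  by move=> t; apply: continuous_comp; [exact: H2|exact: continuous_expR].
have sub S : measurable S -> S `<=` `[0, pi *+ 2[ -> forall g : R -> R, continuous g ->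
    leb.-integrable S (EFin \o g).
  move=> mS SD g cg; apply: integrableS (continuous_itv_integrable 0 (pi *+ 2) cg) => //.
  by move=> t /SD; apply: subset_itvl; rewrite bnd_simp.
have AD : A `<=` `[0, pi *+ 2[ by move=> t [].
have BD : B `<=` `[0, pi *+ 2[ by move=> t [].
have D : `[0, pi *+ 2[%classic = A `|` B by rewrite setDUK.
apply: (le_trans H3).
rewrite -Rintegral_itv_bndo_bndc; last by apply: sub.
rewrite D Rintegral_setU //; last 2 first.
- by rewrite -D; apply: sub.
- by apply/disj_setPS => t [At [_ /(_ At)]].
apply: lerD.
  apply: (@le_trans _ _ (\int[leb]_(t in A) (ln N + N^-1 * absq P.[expi t]))).
    apply: le_Rintegral => //; first exact: sub.
      by apply: sub => // t; apply: cvgD; [exact: cvg_cst|apply: cvgM; [exact: cvg_cst|exact: ecf]].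
    move=> t _; have /andP[p0 _] := H1 (expi t).
    have e : absq P.[expi t] = N * (absq P.[expi t] / N) by rewrite mulrC divfK ?gt_eqF.
    have q0 : 0 < absq P.[expi t] / N by rewrite divr_gt0.
    by rewrite [in leLHS]e lnM ?posrE // lerD2l [N^-1 * _]mulrC ltW // ln_sublinear.
  rewrite RintegralD //; last 2 first.
  - by apply: sub => // t; exact: cvg_cst.
  - by apply: sub => // t; apply: cvgM; [exact: cvg_cst|exact: ecf].
  rewrite Rintegral_cst // RintegralZl //; last exact: sub.
  rewrite mulrC lerD2l ler_pdivrMl // mulrC -lee_fin.
  rewrite fineK; first exact: density_ge_sqnorm.
  by apply: integrable_fin_num => //; exact: (sub A mA AD _ ecf).
apply: (@le_trans _ _ (\int[leb]_(t in B) (n%:R * ln 4))); last first.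
  by rewrite Rintegral_cst // mulrC.
apply: le_Rintegral => //; [exact: sub|by apply: sub => // t; exact: cvg_cst|].
move=> t _; have /andP[p0 p4] := H1 (expi t).
by rewrite mulr_natl -lnXn // ler_ln ?posrE // exprn_gt0.
Qed.

End erdos_turan.

(** * The Erdos-Turan criterion *)

Theorem theorem3p1 (R : realType)
    (mu : {finite_measure set (circle R) -> \bar R})
    (mu_s : {measure set (circle R) -> \bar R}) (w : R -> R)
    (w_meas : measurable_fun `[0, pi *+ 2[ w)
    (w_pos : {ae lebesgue_measure, forall t : R, t \in `[0, pi *+ 2[ -> 0 < w t})
    (mu_s_sing : lebesgue_singular mu_s)
    (mu_decomp : forall A : set (circle R), measurable A ->
       mu A = (\int[lebesgue_measure]_(t in `[0%R, (pi *+ 2)%R[ `&` @expi R @^-1` A)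
                 (w t / (pi *+ 2))%R%:E + mu_s A)%E) :
  circle_regular mu.
Proof.
have pi0 := pi_gt0 R.
have Ndef P : P != 0 -> 0 < sqnorm mu P := sqnorm_gt0 w_meas w_pos mu_decomp (P := P).
pose N n := sqnorm mu (monic_OP mu n).
have N0 n : 0 < N n := sqnorm_monic_OP_gt0 Ndef n.
have N1n n : N n.+1 <= N 1.
  by elim: n => // n IH; exact: le_trans (sqnorm_monic_OP_decr Ndef n.+1) IH.
pose L n : R := n%:R^-1 * ((ln (N n.+1) - ln (N 1)) / 2).
have uE n : (\prod_(1 <= k < n.+1) rho mu k) `^ n%:R^-1 = expR (L n).
  rewrite (prod_rho Ndef) -/(N _) -/(N _).
  have r0 : 0 < N n.+1 / N 1 by rewrite divr_gt0.
  rewrite -powR12_sqrt ?ltW // /powR gt_eqF // gt_eqF ?expR_gt0 // expRK.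
  by rewrite ln_div ?posrE // [2^-1 * _]mulrC.
rewrite /circle_regular; under eq_fun do rewrite uE.
suff : expR (L n) @[n --> \oo] --> expR 0 by rewrite expR0.
suff L0 : L @ \oo --> 0 by apply: continuous_cvg => //; exact: continuous_expR.
have ln4 : 0 < ln 4 :> R by apply: ln_gt0; lra.
apply/cvgrPdist_lt => e e0.
(* b <= h makes a >= pi and the contribution b (n + 1) ln 4 / pi at most e n *)
pose h := Num.min pi (e * pi / (2 * ln 4)).
have h0 : 0 < h by rewrite lt_min pi0 /= divr_gt0 ?mulr_gt0.
have [d d0 hd] := density_ge_complement w_meas w_pos h0.
pose K := (`|ln (N 1)| + 2 / d) / 2.
near=> n.
have n0 : (0 < n)%N by near: n; exists 1%N.
have nK : K * 2 / e < n%:R by near: n; exact: nbhs_infty_gtr.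
have n1 : 1 <= n%:R :> R by rewrite ler1n.
have L_le0 : L n <= 0.
  by rewrite mulr_ge0_le0 ?invr_ge0 // ler_pdivrMr // mul0r subr_le0 ler_ln ?posrE.
rewrite sub0r normrN ler0_norm //.
have := log_sqnorm_lower w_meas w_pos mu_decomp n.+1 d0.
have mA := measurable_density_ge w_meas d.
have mB : measurable (`[0, pi *+ 2[%classic `\` density_ge w d) by exact: measurableD.
have abE : (lebesgue_measure (density_ge w d) +
    lebesgue_measure (`[0%R, (pi *+ 2)%R[%classic `\` density_ge w d) = (pi *+ 2)%:E)%E.
  have AD : density_ge w d `<=` `[0, pi *+ 2[ by move=> t [].
  rewrite -leb_circle_itv -[in RHS](setDUK AD) measureU // setDE setIA.
  by rewrite (setIC (density_ge w d)) -setIA setICr setI0.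
set a := fine _; set b := fine _ => low.
have fin_lt S : (lebesgue_measure S <= (pi *+ 2 : R)%:E)%E -> lebesgue_measure S \is a fin_num.
  by move=> h1; rewrite ge0_fin_numE //; apply: le_lt_trans h1 _; rewrite ltry.
have fA : lebesgue_measure (density_ge w d) \is a fin_num.
  by apply: fin_lt; rewrite -abE leeDl.
have fB : lebesgue_measure (`[0%R, (pi *+ 2)%R[%classic `\` density_ge w d) \is a fin_num.
  by apply: fin_lt; rewrite -abE leeDr.
have ab : a + b = pi *+ 2.
  by apply: EFin_inj; rewrite EFinD /a /b !fineK.
have b0 : 0 <= b by apply: fine_ge0.
have bh : b < h by rewrite -lte_fin fineK.
have [bpi bc] : b <= pi /\ b <= e * pi / (2 * ln 4).
  by move: bh; rewrite /h lt_min => /andP[/ltW-> /ltW->].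
have api : pi <= a by rewrite mulr2n in ab; lra.
have pid : 0 <= pi *+ 2 / d by rewrite divr_ge0 ?ltW // mulrn_wgt0.
have blow : b * (2 * ln 4) <= e * pi by rewrite -ler_pdivlMr // mulr_gt0.
have NS : (n.+1%:R : R) = n%:R + 1 by rewrite -addn1 natrD.
(* when ln N_(n+1) < 0, the factor a may be replaced with pi <= a *)
have key : - ln (N n.+1) <= 2 / d + e * n%:R.
  have [lN|lN] := leP 0 (ln (N n.+1)).
    by apply: (@le_trans _ _ 0); [lra|apply: addr_ge0; [apply: divr_ge0|apply: mulr_ge0] => //; exact: ltW].
  have h1 : a * ln (N n.+1) <= pi * ln (N n.+1) by rewrite ler_nM2r.
  have h2 : b * (n.+1%:R * ln 4) <= e * pi * n%:R.
    rewrite NS; apply: (@le_trans _ _ (b * (2 * ln 4) * n%:R)); last by rewrite ler_wpM2r.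
    have -> : b * (2 * ln 4) * n%:R = b * ((n%:R + n%:R) * ln 4) by ring.
    apply: ler_wpM2l => //; apply: ler_wpM2r; first exact: ltW.
    by rewrite lerD2l.
  rewrite -(ler_pM2l pi0) mulrDr [pi * (2 / d)]mulrA -[pi * 2]/(pi * 2%:R) mulr_natr.
  rewrite -/(N n.+1) in low; lra.
have NK : K * 2 < n%:R * e by rewrite -ltr_pdivrMr.
have KE : K * 2 = `|ln (N 1)| + 2 / d by rewrite /K divfK.
have l1 := ler_norm (ln (N 1)).
rewrite /L -mulrN ltr_pdivrMl ?ltr0n // -mulNr opprB ltr_pdivrMr //.
by clear -key NK KE l1; lra.
Unshelve. all: by end_near. Qed.
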